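(* Let $(R,\mathfrak m)$ be a Cohen-Macaulay local ring of dimension $d\ge1$ with infinite residue field, and let $I_1,I_2$ be $\mathfrak m$-primary ideals such that $I_2$ has minimal multiplicity with respect to $I_1$. Let $(x_1,\dots,x_d)$ be a minimal reduction of $I_2$ and assume that $(x_1,\dots,x_d)\subseteq I_1$. Then: (1) $\displaystyle\sum_{n\ge0}\ell\!\left(\frac R{I_1I_2^n}\right)t^n=\frac{\ell(R/I_1)-t\,[\ell(R/I_1)-e_0(I_2)]}{(1-t)^{d+1}}.$ (2) $g_{1,I_1}(I_2)=e_0(I_2)-\ell(R/I_1)$, and $g_{i,I_1}(I_2)=0$ for $2\le i\le d$. (3) $\displaystyle\sum_{n\ge0}\ell\!\left(\frac{I_2^n}{I_1I_2^n}\right)t^n=\frac{\ell(R/I_1)-t\,[\ell(R/I_1)-e_0(I_2)]}{(1-t)^{d+1}}-\sum_{n\ge0}\ell\!\left(\frac R{I_2^n}\right)t^n.$ (4) $f_{0,I_1}(I_2)=e_1(I_2)-e_0(I_2)+\ell(R/I_1)$, and $f_{i,I_1}(I_2)=e_{i+1}(I_2)$ for $1\le i\le d-1$.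
   Context: $\ell$ denotes length and $e_0(I_2)$ is the multiplicity of $I_2$. The ideal $I_2$ has minimal multiplicity with respect to $I_1$ if $\ell(I_1I_2/I_1J)=0$ for some minimal reduction $J$ of $I_2$ generated by $d$ elements. The coefficients $g_{i,I_1}(I_2)$, $e_i(I_2)$ ($0\le i\le d$) and $f_{i,I_1}(I_2)$ ($0\le i\le d-1$) are defined, for $n\gg0$, by $$\ell(R/I_1I_2^n)=\sum_{i=0}^d(-1)^ig_{i,I_1}(I_2)\binom{n+d-i-1}{d-i},\qquad \ell(R/I_2^n)=\sum_{i=0}^d(-1)^ie_i(I_2)\binom{n+d-i-1}{d-i},$$ $$\ell(I_2^n/I_1I_2^n)=\sum_{i=0}^{d-1}(-1)^if_{i,I_1}(I_2)\binom{n+d-1-i}{d-1-i}.$$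
   Formalization: The coefficients g_i and e_i are defined with binomials C(n+d-i, d-i) instead of C(n+d-i-1, d-i); with the latter, (2) and (4) fail, e.g. for R=k[[x]], I_1=I_2=(x), where g_1=-1 rather than 0 and f_0=1 rather than 0. *)

(* Defs.v *)
(* MathComp + mathcomp-classical. *)
From mathcomp Require Import all_boot all_order all_algebra.
From mathcomp Require Import all_classical.

Set Implicit Arguments.
Unset Strict Implicit.
Unset Printing Implicit Defensive.

Import GRing.Theory.

Local Open Scope classical_set_scope.
Local Open Scope ring_scope.

(* Ideals are Prop-valued subsets: the [idealr] structure of the library
   excludes the unit ideal, which is needed here as I^0. *)
Section Ideals.
Variable R : comNzRingType.
Implicit Types (I J K M N P m : set R) (s : seq R).

Definition is_ideal I : Prop :=
  [/\ I 0, (forall x y, I x -> I y -> I (x + y))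
    & (forall a x, I x -> I (a * x))].

Definition ideal_gen (X : set R) : set R :=
  \bigcap_(I in [set I | is_ideal I /\ X `<=` I]) I.

Definition ideal_mul I J : set R :=
  ideal_gen [set z | exists x y, [/\ I x, J y & z = x * y]].

Definition ideal_exp I (n : nat) : set R := iter n (ideal_mul I) setT.

Definition proper_ideal_set I : Prop := is_ideal I /\ ~ I 1.

Definition prime_ideal P : Prop :=
  proper_ideal_set P /\ forall x y, P (x * y) -> P x \/ P y.

Definition maximal_ideal m : Prop :=
  proper_ideal_set m /\ forall J, proper_ideal_set J -> m `<=` J -> J = m.

Definition radical I : set R := [set x | exists n : nat, I (x ^+ n)].

Definition primary_ideal I : Prop :=
  proper_ideal_set I /\ forall x y, I (x * y) -> I x \/ radical I y.

Definition primary_to m I : Prop := primary_ideal I /\ radical I = m.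

Definition noetherian : Prop :=
  forall I, is_ideal I -> exists s, I = ideal_gen [set` s].

Definition noetherian_local m : Prop :=
  [/\ noetherian, maximal_ideal m & forall m', maximal_ideal m' -> m' = m].

(* The elements of the residue field R/m are the cosets of m. *)
Definition infinite_residue_field m : Prop :=
  infinite_set (range (fun r : R => [set x | m (x - r)])).

(* A strictly increasing chain c 0 < ... < c k has length k. *)
Definition has_chain (C : set (set R)) (k : nat) : Prop :=
  exists c : nat -> set R,
    (forall i, (i <= k)%N -> C (c i)) /\
    (forall i, (i < k)%N -> c i `<` c i.+1).

Definition max_chain_length (C : set (set R)) (k : nat) : Prop :=
  has_chain C k /\ forall j, has_chain C j -> (j <= k)%N.

Definition krull_dim (d : nat) : Prop := max_chain_length prime_ideal d.

Definition regular_sequence s : Prop :=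
  ~ ideal_gen [set` s] 1 /\
  forall i, (i < size s)%N ->
    forall r, ideal_gen [set` take i s] (s`_i * r) ->
      ideal_gen [set` take i s] r.

Definition regular_in m s : Prop :=
  regular_sequence s /\ (forall x, x \in s -> m x).

Definition depth m (k : nat) : Prop :=
  (exists s, regular_in m s /\ size s = k) /\
  (forall s, regular_in m s -> (size s <= k)%N).

Definition cohen_macaulay_local m (d : nat) : Prop :=
  [/\ noetherian_local m, krull_dim d & depth m d].

(* [has_length M N k]: the R-module M/N has (finite) length k. Submodules of
   M/N are the ideals between N and M. *)
Definition has_length M N (k : nat) : Prop :=
  max_chain_length [set L | [/\ is_ideal L, N `<=` L & L `<=` M]] k.

(* The length of M/N; the value is meaningful only when it is finite. *)
Definition length M N : nat := xget 0%N [set k | has_length M N k].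

Definition reduction J I : Prop :=
  [/\ is_ideal J, J `<=` I &
      exists n : nat, ideal_mul J (ideal_exp I n) = ideal_exp I n.+1].

Definition minimal_reduction J I : Prop :=
  reduction J I /\ forall K, reduction K I -> K `<=` J -> K = J.

(* [has_length _ _ 0] rather than [length _ _ = 0], which would also hold in
   the case of infinite length. *)
Definition minimal_multiplicity (d : nat) I2 I1 : Prop :=
  exists J, [/\ minimal_reduction J I2,
                exists y : 'I_d -> R, J = ideal_gen (range y)
              & has_length (ideal_mul I1 I2) (ideal_mul I1 J) 0].

End Ideals.

(* [c 0, ..., c k] are the coefficients of the polynomial of degree <= k that
   agrees with [H] at all large [n]. The k-th normalisation uses the binomials
   C(n + k - i, k - i), the one for which the coefficients of a series
   h(t) / (1 - t)^(k + 1) are c i = h^(i)(1) / i!. It is used with k = d for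
   the lengths of R/I^n and R/(I1 I2^n), and with k = d - 1 for those of
   I2^n/(I1 I2^n). In terms of the coefficients c' relative to the binomials
   C(n + k - i - 1, k - i) one has c 0 = c' 0 and c (i + 1) = c' (i + 1) + c' i,
   so the multiplicity c 0 does not depend on the choice. *)
Definition hilbert_coefs (k : nat) (H : nat -> nat) (c : nat -> int) : Prop :=
  exists N : nat, forall n : nat, (N <= n)%N ->
    (H n)%:Z = \sum_(i < k.+1)
                 (-1) ^+ i * c i * ('C(n + k - i, k - i))%:Z.

(* The coefficients of the power series p / (1 - t)^k; dividing by 1 - t
   amounts to taking partial sums. *)
Definition series_quot (p : {poly int}) (k : nat) : nat -> int :=
  iter k (fun (a : nat -> int) n => \sum_(i < n.+1) a i) (fun n => p`_n).

Lemma series_quotP (p : {poly int}) (k N n : nat) : (n < N)%N ->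
  ((1 - 'X) ^+ k * \poly_(j < N) series_quot p k j)`_n = p`_n.
Proof.
elim: k n => [|k IHk] n ltnN; first by rewrite mul1r coef_poly ltnN.
rewrite exprSr -mulrA -[RHS]IHk // !coefM; apply: eq_bigr => i _.
congr (_ * _); rewrite mulrBl mul1r coefB coefXM !coef_poly.
have lt_niN : (n - i < N)%N by apply: leq_ltn_trans ltnN; apply: leq_subr.
rewrite lt_niN; case: (n - i)%N lt_niN => [|q] ltqN /=.
  by rewrite subr0 /= big_ord_recr big_ord0 /= add0r.
by rewrite (ltnW ltqN) /= big_ord_recr /= addrC addrK.
Qed.

(* Main.v *)
(* By the linear change of generators that prime avoidance provides over an
   infinite residue field, every system of d generators of an m-primary ideal is
   a regular sequence. If J is such an ideal and K contains J, then J^n / K J^n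
   is free over R/K on the monomials of degree n, so that
     l(R / K J^n) = l(R/J) C(n+d-1, d) + l(R/K) C(n+d-1, d-1).
   A reduction J of I2 has colength e_0(I2), by comparing R/J^n with R/I2^n.

   Let X = (x_1, ..., x_d), let J be the reduction with I1 I2 = I1 J, and put
   K = I1 + I2. As X is contained in I1, X K <= I1 I2 = I1 J <= K J, and X K and
   K J have the same colength; hence I1 J = K J, J^2 <= I1 J, and this forces
   J <= I1. The formula above, with I1 for K, then gives the length of
   R / I1 I2^n = R / I1 J^n for all n, and the rest is a computation with
   binomial coefficients. *)

From HB Require Import structures.
Require Import Defs.
From mathcomp Require Import all_boot all_order all_algebra.
From mathcomp Require Import all_classical.
From mathcomp Require Import zify ring.

Set Implicit Arguments.
Unset Strict Implicit.
Unset Printing Implicit Defensive.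

Import Order.TTheory GRing.Theory Num.Theory.

Local Open Scope classical_set_scope.
Local Open Scope ring_scope.

(** * The semiring of ideals *)

(* Sum and product make the ideals a commutative semiring with zero {0} and
   unit R, which gives access to the algebraic lemmas on [+], [*] and [^+]. *)
Record ideal (R : comNzRingType) := Ideal {
  ideal_mem :> R -> Prop;
  ideal_memP : is_ideal ideal_mem }.

HB.instance Definition _ R := gen_eqMixin (ideal R).
HB.instance Definition _ R := gen_choiceMixin (ideal R).

Definition ideal_sub (R : comNzRingType) (I J : ideal R) : Prop :=
  forall x, I x -> J x.

Notation "I \sub J" := (ideal_sub I%R J%R) (at level 70, no associativity).
Notation "x \mem I" := (ideal_mem I%R x%R) (at level 70, no associativity).

Section IdealSemiring.
Variable R : comNzRingType.
Implicit Types (I J K L M N Z : ideal R) (a b r x y z : R) (s : seq R).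

Lemma ideal0 I : I 0. Proof. by case: (ideal_memP I). Qed.

Lemma idealD I x y : I x -> I y -> I (x + y).
Proof. by case: (ideal_memP I) => _ + _; apply. Qed.

Lemma idealMl I a x : I x -> I (a * x).
Proof. by case: (ideal_memP I) => _ _; apply. Qed.

Lemma idealMr I a x : I x -> I (x * a).
Proof. by rewrite mulrC; apply: idealMl. Qed.

Lemma idealN I x : I x -> I (- x).
Proof. by rewrite -mulN1r; apply: idealMl. Qed.

Lemma idealB I x y : I x -> I y -> I (x - y).
Proof. by move=> Ix Iy; apply/idealD/idealN. Qed.

Lemma ideal_subr I x y : I y -> I (x + y) -> I x.
Proof. by move=> Iy Ixy; rewrite -(addrK y x); apply: idealB. Qed.

(** Leibniz equality, by extensionality and proof irrelevance, so that the semiring laws become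
    equations and ideals can be rewritten. *)
Lemma ideal_ext I J : I \sub J -> J \sub I -> I = J.
Proof.
case: I J => [I hI] [J hJ] /= IJ JI.
have E : I = J by apply/funext => x; apply/propext; split; [apply: IJ|apply: JI].
by case: _ / E hJ {IJ JI} => hJ; congr Ideal; apply: Prop_irrelevance.
Qed.

Lemma ideal_sub_trans J I K : I \sub J -> J \sub K -> I \sub K.
Proof. by move=> IJ JK x /IJ /JK. Qed.

Fact ideal_zero_subproof : is_ideal (fun x : R => x = 0).
Proof. by split=> // [x y -> ->|a x ->]; rewrite ?addr0 ?mulr0. Qed.
Definition ideal_zero := Ideal ideal_zero_subproof.

Fact ideal_unit_subproof : is_ideal (fun _ : R => True).
Proof. by []. Qed.
Definition ideal_unit := Ideal ideal_unit_subproof.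

Fact ideal_add_subproof I J :
  is_ideal (fun x : R => exists i j, [/\ I i, J j & x = i + j]).
Proof.
split=> [|x y [i [j [Ii Jj ->]]] [i' [j' [Ii' Jj' ->]]]|a x [i [j [Ii Jj ->]]]].
- by exists 0, 0; rewrite addr0; split => //; apply: ideal0.
- by exists (i + i'), (j + j'); rewrite addrACA; split => //; apply: idealD.
- by exists (a * i), (a * j); rewrite mulrDr; split => //; apply: idealMl.
Qed.
Definition ideal_add I J := Ideal (ideal_add_subproof I J).
Arguments ideal_add : simpl never.

Fact ideal_gen_is_ideal (X : set R) : is_ideal (ideal_gen X).
Proof.
split=> [I [hI XI]|x y hx hy I [hI XI]|a x hx I [hI XI]].
- by case: hI.
- by case: (hI) => _ + _; apply; [apply: hx|apply: hy].
- by case: (hI) => _ _; apply; apply: hx.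
Qed.

Lemma ideal_gen_inc (X : set R) : X `<=` ideal_gen X.
Proof. by move=> x Xx I [_]; apply. Qed.

Lemma ideal_gen_sub (X : set R) I : X `<=` I -> ideal_gen X `<=` I.
Proof. by move=> XI x; apply; split=> //; apply: ideal_memP. Qed.

Definition ideal_prod I J :=
  Ideal (ideal_gen_is_ideal [set z | exists x y, [/\ I x, J y & z = x * y]]).

Arguments ideal_prod : simpl never.

Lemma ideal_prod_mem I J x y : I x -> J y -> ideal_prod I J (x * y).
Proof. by move=> Ix Jy; apply: ideal_gen_inc; exists x, y. Qed.

Lemma ideal_prod_sub I J K :
  (forall x y, I x -> J y -> K (x * y)) -> ideal_prod I J \sub K.
Proof. by move=> IJK; apply: ideal_gen_sub => _ [x [y [Ix Jy ->]]]; apply: IJK. Qed.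

Fact ideal_addA : associative ideal_add.
Proof.
move=> I J K; apply: ideal_ext => x.
  move=> [i [_ [Ii [j [k [Jj Kk ->]]] ->]]].
  by exists (i + j), k; rewrite addrA; split => //; exists i, j.
move=> [_ [k [[i [j [Ii Jj ->]]] Kk ->]]].
by exists i, (j + k); rewrite addrA; split => //; exists j, k.
Qed.

Fact ideal_addC : commutative ideal_add.
Proof.
by move=> I J; apply: ideal_ext => x [i [j [Ii Jj ->]]]; exists j, i; rewrite addrC.
Qed.

Fact ideal_add0 : left_id ideal_zero ideal_add.
Proof.
move=> I; apply: ideal_ext => x; first by move=> [_ [j [-> Jj ->]]]; rewrite add0r.
by move=> Ix; exists 0, x; rewrite add0r.
Qed.

HB.instance Definition _ :=
  GRing.isNmodule.Build (ideal R) ideal_addA ideal_addC ideal_add0.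

Lemma ideal_subDl I J : I \sub I + J.
Proof. by move=> x Ix; exists x, 0; rewrite addr0; split => //; apply: ideal0. Qed.

Lemma ideal_subDr I J : J \sub I + J.
Proof. by rewrite addrC; apply: ideal_subDl. Qed.

Lemma ideal_subD I J K : I \sub K -> J \sub K -> I + J \sub K.
Proof. by move=> IK JK x [i [j [/IK Ki /JK Kj ->]]]; apply: idealD. Qed.

Lemma ideal_subDD I J I' J' : I \sub I' -> J \sub J' -> I + J \sub I' + J'.
Proof. by move=> II JJ x [i [j [/II Ki /JJ Kj ->]]]; exists i, j. Qed.

Fact ideal_mulC : commutative ideal_prod.
Proof.
move=> I J; apply: ideal_ext; apply: ideal_prod_sub => x y Ix Jy;
  by rewrite mulrC; apply: ideal_prod_mem.
Qed.

Fact colon_subproof I a : is_ideal (fun r : R => I (r * a)).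
Proof.
split=> [|x y Ix Iy|b x Ix]; rewrite ?mul0r; first exact: ideal0.
  by rewrite mulrDl; apply: idealD.
by rewrite -mulrA; apply: idealMl.
Qed.
Definition colon I a := Ideal (colon_subproof I a).

Lemma mem_colon I a r : r \mem colon I a = I (r * a). Proof. by []. Qed.

Fact ideal_mulA : associative ideal_prod.
Proof.
have H I J K : ideal_prod (ideal_prod I J) K \sub ideal_prod I (ideal_prod J K).
  apply: ideal_prod_sub => x k IJx Kk.
  (* The multipliers sending k into the target form an ideal, so it is enough to treat
     generators. *)
  suff H : ideal_prod I J \sub colon (ideal_prod I (ideal_prod J K)) k by apply: H.
  apply: ideal_prod_sub => i j Ii Jj.
  by rewrite mem_colon -mulrA; apply: ideal_prod_mem => //; apply: ideal_prod_mem.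
move=> I J K; apply: ideal_ext => //.
have := H K J I.
by rewrite (ideal_mulC _ I) (ideal_mulC K J) (ideal_mulC K _) (ideal_mulC J I).
Qed.

Fact ideal_mul1 : left_id ideal_unit ideal_prod.
Proof.
move=> I; apply: ideal_ext; first by apply: ideal_prod_sub => x y _; apply: idealMl.
by move=> x Ix; rewrite -(mul1r x); apply: ideal_prod_mem.
Qed.

Fact ideal_mulDl : left_distributive ideal_prod +%R.
Proof.
move=> I J K; apply: ideal_ext.
  apply: ideal_prod_sub => _ k [i [j [Ii Jj ->]]] Kk.
  by exists (i * k), (j * k); rewrite mulrDl; split=> //; apply: ideal_prod_mem.
apply: ideal_subD; apply: ideal_prod_sub => x y Ix Jy; apply: ideal_prod_mem => //.
  exact: ideal_subDl.
exact: ideal_subDr.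
Qed.

Fact ideal_mul0 : left_zero (0 : ideal R) ideal_prod.
Proof.
move=> I; apply: ideal_ext; first by apply: ideal_prod_sub => x y -> _; rewrite mul0r.
by move=> x ->; apply: ideal0.
Qed.

HB.instance Definition _ :=
  GRing.Nmodule_isComPzSemiRing.Build (ideal R)
    ideal_mulA ideal_mulC ideal_mul1 ideal_mulDl ideal_mul0.

Lemma ideal0_sub I : 0 \sub I.
Proof. by move=> x ->; apply: ideal0. Qed.

Lemma idealM_mem I J x y : I x -> J y -> x * y \mem I * J.
Proof. exact: ideal_prod_mem. Qed.

Lemma idealM_sub I J K : (forall x y, I x -> J y -> K (x * y)) -> I * J \sub K.
Proof. exact: ideal_prod_sub. Qed.

Lemma idealM_subM I J I' J' : I \sub I' -> J \sub J' -> I * J \sub I' * J'.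
Proof. by move=> II JJ; apply: idealM_sub => x y /II ? /JJ; apply: idealM_mem. Qed.

Lemma idealM_subl I J : I * J \sub I.
Proof. by apply: idealM_sub => x y Ix _; apply: idealMr. Qed.

Lemma idealM_subr I J : I * J \sub J.
Proof. by rewrite mulrC; apply: idealM_subl. Qed.

Lemma idealX_sub I J n : I \sub J -> I ^+ n \sub J ^+ n.
Proof. by move=> IJ; elim: n => // n IHn; rewrite !exprS; apply: idealM_subM. Qed.

Lemma idealDK I J : I \sub J -> I + J = J.
Proof. by move=> IJ; apply: ideal_ext; [apply: ideal_subD|apply: ideal_subDr]. Qed.

Fact ideal_cap_subproof I J : is_ideal (fun x : R => I x /\ J x).
Proof.
split=> [|x y [Ix Jx] [Iy Jy]|a x [Ix Jx]]; split;
  by [apply: ideal0|apply: idealD|apply: idealMl].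
Qed.
Definition ideal_cap I J := Ideal (ideal_cap_subproof I J).

Fact pideal_subproof a : is_ideal (fun x : R => exists c, x = c * a).
Proof.
split=> [|x y [c ->] [c' ->]|b x [c ->]]; first by exists 0; rewrite mul0r.
  by exists (c + c'); rewrite mulrDl.
by exists (b * c); rewrite mulrA.
Qed.
Definition pideal a := Ideal (pideal_subproof a).

Lemma pideal_id a : pideal a a. Proof. by exists 1; rewrite mul1r. Qed.

Lemma pideal_sub a I : I a -> pideal a \sub I.
Proof. by move=> Ia _ [c ->]; apply: idealMl. Qed.

Lemma pideal1 : pideal 1 = 1.
Proof. by apply: ideal_ext => // x _; exists x; rewrite mulr1. Qed.

Lemma pidealM a I x : x \mem pideal a * I <-> exists2 i, I i & x = i * a.
Proof.
split=> [|[i Ii ->]]; last by rewrite mulrC; apply: idealM_mem => //; apply: pideal_id.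
have H : is_ideal (fun x => exists2 i, I i & x = i * a).
  split=> [|y z [i Ii ->] [j Ij ->]|b y [i Ii ->]].
  - by exists 0; rewrite ?mul0r //; apply: ideal0.
  - by exists (i + j); rewrite ?mulrDl //; apply: idealD.
  - by exists (b * i); rewrite ?mulrA //; apply: idealMl.
suff sub : pideal a * I \sub Ideal H by apply: sub.
by apply: idealM_sub => _ i [c ->] Ii; exists (c * i); [apply: idealMl|ring].
Qed.

End IdealSemiring.

(** * Lengths *)

Section Lengths.
Variable R : comNzRingType.
Implicit Types (I J K L M N Z : ideal R) (a b r x y z : R).

(** The bottom term is N itself and the top term only has to lie in M; the recursion prepends a
    smaller ideal. *)
Fixpoint chain N M (k : nat) : Prop :=
  if k is k'.+1 then exists L, [/\ N \sub L, ~ L \sub N & chain L M k'] else N \sub M.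

Lemma chain_subl N N' M k : N \sub N' -> chain N' M k -> chain N M k.
Proof.
case: k => [|k] NN' /=; first exact: ideal_sub_trans.
move=> [L [N'L LN' LM]]; exists L; split => //; first exact: ideal_sub_trans N'L.
by move=> LN; apply: LN'; apply: ideal_sub_trans NN'.
Qed.

Lemma chain_subr N M M' k : M \sub M' -> chain N M k -> chain N M' k.
Proof.
move=> MM'; elim: k N => [|k IHk] N /=; first by move=> NM; apply: ideal_sub_trans MM'.
by move=> [L [NL LN /IHk]]; exists L.
Qed.

Lemma chain_sub N M k : chain N M k -> N \sub M.
Proof.
elim: k N => [|k IHk] N //= [L [NL _ /IHk LM]]; exact: ideal_sub_trans LM.
Qed.

Lemma chain_cat N L M j k : chain N L j -> chain L M k -> chain N M (j + k).
Proof.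
elim: j N => [|j IHj] N /=; first exact: chain_subl.
by move=> [L' [NL' L'N /IHj ch]] /ch; exists L'.
Qed.

(* By modularity, N < N' forces N :&: L < N' :&: L or N + L < N' + L. *)
Lemma chain_split N L M k : N \sub L -> L \sub M -> chain N M k ->
  exists i j, [/\ (k <= i + j)%N, chain N L i & chain L M j].
Proof.
move=> NL LM.
suff H N' : chain N' M k -> exists i j,
    [/\ (k <= i + j)%N, chain (ideal_cap N' L) L i & chain (N' + L) M j].
  move=> /H [i [j [kij chi chj]]]; exists i, j; split=> //.
    by apply: chain_subl chi => x Nx; split=> //; apply: NL.
  by apply: chain_subl chj; apply: ideal_subDr.
elim: k N' => [|k IHk] N' /=.
  move=> N'M; exists 0, 0; split => //= x; first by case.
  by move: x; apply: ideal_subD.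
move=> [N2 [N'N2 N2N' /IHk [i [j [kij chi chj]]]]].
have subI : ideal_cap N' L \sub ideal_cap N2 L by move=> x [/N'N2].
have subD : N' + L \sub N2 + L by apply: ideal_subDD.
have [N2LI|N2LI] := pselect (ideal_cap N2 L \sub ideal_cap N' L); last first.
  exists i.+1, j; split; rewrite ?addSn //=; last exact: chain_subl chj.
  by exists (ideal_cap N2 L).
have [N2LD|N2LD] := pselect (N2 + L \sub N' + L); last first.
  exists i, j.+1; split; rewrite ?addnS //=; first exact: chain_subl chi.
  by exists (N2 + L).
case: N2N' => x N2x; have [|n' [l [N'n' Ll xE]]] := N2LD x.
  exact: ideal_subDl.
suff [N'l _] : ideal_cap N' L l by rewrite xE; apply: idealD.
apply: N2LI; split=> //; have -> : l = x - n' by rewrite xE addrC addKr.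
by apply: idealB => //; apply: N'N2.
Qed.

Lemma chain_map (f : ideal R -> ideal R) N M k :
  (forall I J, N \sub I -> I \sub J -> J \sub M -> f I \sub f J) ->
  (forall I J, N \sub I -> I \sub J -> J \sub M -> f J \sub f I -> J \sub I) ->
  chain N M k -> chain (f N) (f M) k.
Proof.
move=> fM fI; have : N \sub N by [].
move: {-1}N; elim: k => [|k IHk] N' NN' /=; first by move=> N'M; apply: fM.
move=> [L [N'L LN' chL]]; exists (f L).
have LM := chain_sub chL; have NL := ideal_sub_trans NN' N'L.
by split; [apply: fM|move/(fI _ _ NN' N'L LM)|apply: IHk].
Qed.

(** The first term of a [has_chain] may lie strictly above N; lowering it to N keeps all inclusions
    strict. *)
Lemma has_chainP N M k : N \sub M ->
  has_chain [set L : set R | [/\ is_ideal L, N `<=` L & L `<=` M]] k <-> chain N M k.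
Proof.
move=> NM; split.
  move=> [c [cC cS]]; have [hc0 Nc0 _] := cC _ (leq0n k).
  apply: (@chain_subl N (Ideal hc0)) => //.
  elim: k c cC cS hc0 {Nc0} => [|k IHk] c cC cS hc0 /=; first by case: (cC 0%N).
  have [hc1 _ _] := cC 1%N isT; exists (Ideal hc1).
  have [c01 c10] := cS 0%N isT; split => //.
  apply: (IHk (fun i => c i.+1)) => i ik; [exact: (cC i.+1)|exact: (cS i.+1)].
move=> chNM; suff [c [cC cS]] : exists c : nat -> set R,
    (forall i, (i <= k)%N -> [/\ is_ideal (c i), N `<=` c i & c i `<=` M]) /\
    (forall i, (i < k)%N -> c i `<` c i.+1) by exists c.
elim: k N NM chNM => [|k IHk] N NM /=.
  by move=> _; exists (fun=> ideal_mem N); split=> // i _; split=> //; apply: ideal_memP.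
move=> [L [NL LN chL]]; have [c [cC cS]] := IHk _ (chain_sub chL) chL.
exists (fun i => if i is i'.+1 then c i' else ideal_mem N); split=> -[|i] ik.
- by split=> //; apply: ideal_memP.
- by have [hc Lc cM] := cC i ik; split=> // x /NL /Lc.
- by have [_ Lc _] := cC _ (leq0n k); split=> [x /NL /Lc //|cN]; apply: LN => x /Lc /cN.
- exact: cS.
Qed.

(* Meaningful only under [finlen M N]. *)
Definition len M N : nat := length (ideal_mem M) (ideal_mem N).

(** A bound on chains rather than a value: it passes to subquotients at once. *)
Definition finlen M N : Prop := exists b : nat, forall k, chain N M k -> (k <= b)%N.

Lemma lenP M N k : N \sub M -> chain N M k -> (forall j, chain N M j -> (j <= k)%N) ->
  len M N = k.
Proof.
move=> NM chk maxk; have hk : has_length (ideal_mem M) (ideal_mem N) k.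
  by split; [apply/has_chainP|move=> j /(has_chainP _ NM)/maxk].
rewrite /len /length; case: xgetP => [l -> [chl maxl]|/(_ k) //].
apply/eqP; rewrite eqn_leq maxk ?maxl //; last exact/has_chainP.
by case: hk.
Qed.

Lemma finlen_max M N : N \sub M -> finlen M N ->
  exists k, chain N M k /\ forall j, chain N M j -> (j <= k)%N.
Proof.
move=> NM [b hb]; elim: b hb => [|b IHb] hb; first by exists 0%N.
have [chb|nchb] := pselect (chain N M b.+1); first by exists b.+1.
apply: IHb => j chj; have := hb _ chj; rewrite leq_eqVlt => /orP[/eqP jE|//].
by case: nchb; rewrite -jE.
Qed.

Lemma len_chain M N : N \sub M -> finlen M N -> chain N M (len M N).
Proof. by move=> NM /(finlen_max NM)[k [chk maxk]]; rewrite (lenP NM chk maxk). Qed.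

Lemma chain_len M N k : finlen M N -> chain N M k -> (k <= len M N)%N.
Proof.
move=> fMN chk; have NM := chain_sub chk.
by have [l [chl maxl]] := finlen_max NM fMN; rewrite (lenP NM chl maxl) maxl.
Qed.

Lemma finlen_sub M N M' N' : M' \sub M -> N \sub N' -> finlen M N -> finlen M' N'.
Proof.
move=> MM NN [b hb]; exists b => k chk; apply: hb.
exact/(chain_subl NN)/(chain_subr MM).
Qed.

Lemma finlenD M L N : N \sub L -> L \sub M -> finlen M L -> finlen L N -> finlen M N.
Proof.
move=> NL LM [b hb] [c hc]; exists (c + b)%N => k /(chain_split NL LM).
by move=> [i [j [kij /hc ic /hb jb]]]; apply: leq_trans kij _; apply: leq_add.
Qed.

Lemma lenD M L N : N \sub L -> L \sub M -> finlen M N ->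
  len M N = (len M L + len L N)%N.
Proof.
move=> NL LM fMN.
have fML : finlen M L by apply: finlen_sub fMN.
have fLN : finlen L N by apply: finlen_sub fMN.
apply: lenP; first exact: ideal_sub_trans LM.
  by rewrite addnC; apply: chain_cat; apply: len_chain.
move=> k /(chain_split NL LM)[i [j [kij chi chj]]].
by apply: leq_trans kij _; rewrite addnC; apply: leq_add; apply: chain_len.
Qed.

Lemma len_id M : len M M = 0%N.
Proof. by apply: lenP => // -[|j] //= [L [ML LM /chain_sub]]. Qed.

Lemma len_eq0 M N : N \sub M -> finlen M N -> len M N = 0%N -> M = N.
Proof.
move=> NM fMN len0; have [MN|nMN] := pselect (M \sub N); first exact: ideal_ext.
suff : (1 <= len M N)%N by rewrite len0.
by apply: (chain_len (k := 1) fMN); exists M; split=> //=.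
Qed.

Lemma has_length_eq0 M N : N \sub M ->
  has_length (ideal_mem M) (ideal_mem N) 0 -> M = N.
Proof.
move=> NM [_ max0]; have [MN|nMN] := pselect (M \sub N); first exact: ideal_ext.
have /max0 // : has_chain [set L : set R | [/\ is_ideal L, N `<=` L & L `<=` M]] 1.
by apply/has_chainP => //; exists M; split=> //=.
Qed.

(* Multiplication by a induces an isomorphism of M / (M :&: (B : a)) onto
   (aM + B) / B. *)
Lemma chain_mull a M B k :
  chain (ideal_cap M (colon B a)) M k <-> chain B (pideal a * M + B) k.
Proof.
have aE I J x : x \mem pideal a * I + J <-> exists2 i, I i & J (x - i * a).
  split=> [[_ [j [/pidealM[i Ii ->] Jj ->]]]|[i Ii Jx]].
    by exists i; rewrite // addrC addKr.
  exists (i * a), (x - i * a); split=> //; last by rewrite addrC subrK.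
  by apply/pidealM; exists i.
split.
  move=> /(chain_map (f := fun I => pideal a * I + B)) ch.
  apply: (@chain_subl _ (pideal a * ideal_cap M (colon B a) + B)).
    exact: ideal_subDr.
  apply: ch => I J capI IJ JM; first by apply: ideal_subDD => //; apply: idealM_subM.
  move=> sub x Jx; have /sub/aE[i Ii Bxi] : x * a \mem pideal a * J + B.
    by apply/aE; exists x; rewrite // subrr; apply: ideal0.
  rewrite -(subrK i x); apply: idealD => //; apply: capI; split; last by rewrite /= mulrBl.
  by apply: JM; apply: idealB => //; apply: IJ.
move=> /(chain_map (f := fun I => ideal_cap M (colon I a))) ch.
apply: (@chain_subr _ (ideal_cap M (colon (pideal a * M + B) a))); first by move=> x [].
apply: ch => I J BI IJ JM; first by move=> x [Mx /= /IJ].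
move=> sub x Jx; have /JM/aE[i Mi Bxi] := Jx.
rewrite -(subrK (i * a) x); apply: idealD; first exact: BI.
suff [] : ideal_cap M (colon I a) i by [].
apply: sub; split=> //; rewrite mem_colon -(subKr x (i * a)).
by apply: idealB => //; apply/IJ/BI.
Qed.

Lemma len_iff M N M' N' : N \sub M -> N' \sub M' ->
  (forall k, chain N M k <-> chain N' M' k) -> len M N = len M' N'.
Proof.
move=> NM NM' E; pose C M N := [set L : set R | [/\ is_ideal L, N `<=` L & L `<=` M]].
have {}E k : has_chain (C M N) k <-> has_chain (C M' N') k.
  by rewrite !has_chainP.
rewrite /len /length; congr xget; apply/seteqP.
by split=> k [/E ch max]; split=> // j /E; apply: max.
Qed.

Lemma len_mull a M B :
  len (pideal a * M + B) B = len M (ideal_cap M (colon B a)).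
Proof.
apply: len_iff => [||k]; last by rewrite chain_mull.
- exact: ideal_subDr.
- by move=> x [].
Qed.

Lemma finlen_mull a M B :
  finlen M (ideal_cap M (colon B a)) -> finlen (pideal a * M + B) B.
Proof. by move=> [b hb]; exists b => k /chain_mull/hb. Qed.

(** The second isomorphism theorem, as multiplication by 1. *)
Lemma lenDr M N : len (M + N) N = len M (ideal_cap M N).
Proof.
have := len_mull 1 M N; rewrite pideal1 mul1r => ->; congr (len _ (ideal_cap _ _)).
by apply: ideal_ext => x /=; rewrite mulr1.
Qed.

End Lengths.

Arguments len {R} (M N)%_ring_scope.
Arguments finlen {R} (M N)%_ring_scope.

(** * Noetherian local rings *)

Section Span.
Variable R : comNzRingType.
Implicit Types (I J K L M N Z : ideal R) (a b r x y z : R) (s t : seq R).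

Definition span s : ideal R := \sum_(a <- s) pideal a.

Lemma span_nil : span [::] = 0. Proof. exact: big_nil. Qed.

Lemma span_cons a s : span (a :: s) = pideal a + span s.
Proof. exact: big_cons. Qed.

Lemma span_cat s t : span (s ++ t) = span s + span t.
Proof. exact: big_cat. Qed.

Lemma span_rcons s a : span (rcons s a) = span s + pideal a.
Proof. by rewrite -cats1 span_cat span_cons span_nil addr0. Qed.

Lemma mem_span s a : a \in s -> span s a.
Proof.
elim: s => // b s IHs; rewrite span_cons in_cons => /orP[/eqP ->|/IHs ?].
  exact/ideal_subDl/pideal_id.
exact: ideal_subDr.
Qed.

Lemma span_sub s I : (forall a, a \in s -> I a) -> span s \sub I.
Proof.
elim: s => [|a s IHs] sI; first by rewrite span_nil; apply: ideal0_sub.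
rewrite span_cons; apply: ideal_subD; first by apply/pideal_sub/sI/mem_head.
by apply: IHs => b bs; apply: sI; rewrite in_cons bs orbT.
Qed.

Lemma ideal_gen_span (X : set R) s :
  (forall x, X x <-> x \in s) -> ideal_gen X = ideal_mem (span s).
Proof.
move=> XE; apply/seteqP; split.
  by apply: ideal_gen_sub => x /XE/mem_span.
suff H : span s \sub Ideal (ideal_gen_is_ideal X) by apply: H.
by apply: span_sub => x /XE; apply: ideal_gen_inc.
Qed.

End Span.

Section Noetherian.
Variable R : comNzRingType.
Hypothesis noethR : noetherian R.
Implicit Types (I J K L M N Z : ideal R) (a b r x y z : R) (s t : seq R).

(** The increasing union of the ideals Z + (a 0, ..., a (n - 1)) is finitely generated, hence
    reached at a finite stage. *)
Lemma noetherian_seq Z (a : nat -> R) : exists n, a n \mem Z + span (mkseq a n).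
Proof.
pose B n := Z + span (mkseq a n).
have BS n : B n \sub B n.+1.
  apply: ideal_subDD => //; rewrite mkseqS span_rcons; exact: ideal_subDl.
have Bmono i j : (i <= j)%N -> B i \sub B j.
  move=> /subnK <-; elim: (j - i)%N => // k IHk.
  by apply: ideal_sub_trans (BS _); rewrite -/(addn _ _).
have hU : is_ideal (fun x => exists n, B n x).
  split=> [|x y [i Bx] [j By]|b x [i Bx]]; first by exists 0%N; apply: ideal0.
    exists (maxn i j); apply: idealD; [apply: Bmono Bx|apply: Bmono By].
      exact: leq_maxl.
    exact: leq_maxr.
  by exists i; apply: idealMl.
have [s] := noethR hU; rewrite (@ideal_gen_span _ _ s) // => UE.
have [N sN] : exists N : nat, forall x, x \in s -> B N x.
  have : forall x, x \in s -> exists n, B n x.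
    move=> x /mem_span; rewrite -(congr1 (fun X => X x) UE); exact.
  elim: s {UE} => [|x s IHs] sB; first by exists 0%N.
  have [N1 B1] := sB x (mem_head _ _).
  have [y ys|N2 B2] := IHs; first by apply: sB; rewrite in_cons ys orbT.
  exists (maxn N1 N2) => y; rewrite in_cons => /orP[/eqP ->|/B2].
    exact: Bmono (leq_maxl _ _) _ B1.
  exact: Bmono (leq_maxr _ _) _.
exists N; apply: (span_sub sN).
rewrite -(congr1 (fun X => X (a N)) UE); exists N.+1.
by rewrite /B mkseqS span_rcons addrA; apply/ideal_subDr/pideal_id.
Qed.

(** Otherwise choice builds a strictly increasing sequence in P, and elements picked from the
    successive differences contradict [noetherian_seq]. *)
Lemma noetherian_max (P : ideal R -> Prop) I0 : P I0 ->
  exists I, P I /\ forall J, P J -> I \sub J -> J \sub I.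
Proof.
move=> PI0; apply: contrapT => nmax.
have step (I : {I | P I}) : exists J : {I | P I},
    sval I \sub sval J /\ exists x, sval J x /\ ~ sval I x.
  apply: contrapT => nJ; apply: nmax; exists (sval I); split; first exact: svalP.
  move=> J PJ IJ x Jx; apply: contrapT => nIx.
  by apply: nJ; exists (exist _ J PJ); split=> //; exists x.
have {nmax step} [f fP] := choice step.
pose c n := sval (iter n f (exist _ I0 PI0)).
have aex n : exists x, c n.+1 x /\ ~ c n x.
  by have [_] := fP (iter n f (exist _ I0 PI0)).
have {aex} [a aP] := choice aex.
have [n] := noetherian_seq 0 a; rewrite add0r => an; have [_] := aP n; apply.
apply: span_sub an => x /mapP[i]; rewrite mem_iota add0n => /andP[_ lin] ->.
have -> : n = (n - i.+1 + i.+1)%N by rewrite subnK.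
elim: (n - i.+1)%N => [|k IHk]; first by have [] := aP i.
by have [+ _] := fP (iter (k + i.+1) f (exist _ I0 PI0)); apply.
Qed.

End Noetherian.

(** Locality is phrased through units, the form that Nakayama arguments use;
    [noetherian_local_ideal] derives it. *)
Definition local_ideal (R : comNzRingType) (m : ideal R) : Prop :=
  [/\ noetherian R, ~ m 1 & forall r, ~ m r -> exists u, u * r = 1].

Section Local.
Variables (R : comNzRingType) (m : ideal R).
Hypothesis locR : local_ideal m.
Implicit Types (I J K L M N Z : ideal R) (a b r x y z : R) (s t : seq R).

Let noethR : noetherian R. Proof. by case: locR. Qed.

(** Among the k in K outside Z take one with Z + (k) maximal. Since k is k' a modulo Z, maximality
    gives k' = z + c k, so (1 - c a) k' lies in Z, and 1 - c a is a unit. *)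
Lemma nakayama_mul (K : R -> Prop) Z a : m a ->
  (forall k, K k -> exists k', K k' /\ Z (k - k' * a)) -> forall k, K k -> Z k.
Proof.
move=> ma step k Kk; apply: contrapT => nZk.
pose P I := exists k, [/\ K k, ~ Z k & I = Z + pideal k].
have [|_ [[{nZk} {}k [{}Kk nZk ->]] maxk]] :=
  @noetherian_max _ noethR P (Z + pideal k); first by exists k.
have [k' [Kk' Zk']] := step k Kk.
have nZk' : ~ Z k'.
  by move=> Zk; apply: nZk; apply: ideal_subr Zk'; apply: idealN; apply: idealMr.
have [|||z [_ [Zz [c ->] k'E]]] := maxk (Z + pideal k') _ _ k'; first by exists k'.
- apply: ideal_subD; first exact: ideal_subDl.
  apply: pideal_sub; exists (k - k' * a), (k' * a); rewrite subrK; split=> //.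
  by exists a; ring.
- exact/ideal_subDr/pideal_id.
have [_ m1 unitm] := locR.
have [|u u1] := unitm (1 - c * a).
  by move=> m1ca; apply: m1; apply: ideal_subr m1ca; apply: idealN; apply: idealMl.
apply: nZk'; rewrite -(mul1r k') -u1 -mulrA; apply: idealMl.
have -> : (1 - c * a) * k' = z + c * (k - k' * a) by rewrite mulrBl {1}k'E; ring.
by apply: idealD => //; apply: idealMl.
Qed.

Lemma finlen1m : finlen 1 m.
Proof.
exists 1%N => -[|[|k]] //= [L [mL Lm [L' [LL' L'L _]]]].
case: Lm => x Lx; apply: contrapT => nmx; apply: L'L => y _.
have [_ _ /(_ _ nmx)[u u1]] := locR.
by rewrite -(mul1r y) -u1 -mulrA mulrCA; apply: idealMr.
Qed.

(* At an ideal maximal among those of infinite colength, the annihilator of a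
   socle element contributes a factor R/m of length 1. *)
Lemma finlen_primary I : (forall r, m r -> exists n, I (r ^+ n)) -> finlen 1 I.
Proof.
move=> mI; apply: contrapT => nfin.
have [|{nfin} J [[IJ nfin] maxJ]] :=
  @noetherian_max _ noethR (fun J => I \sub J /\ ~ finlen 1 J) I; first by split.
have nJ1 : ~ J 1.
  move=> J1; apply: nfin; exists 0%N => -[|k] //= [L [_ LJ _]]; case: LJ => x _.
  by rewrite -(mulr1 x); apply: idealMl.
have [|_ [[r [nJr ->]] maxr]] :=
  @noetherian_max _ noethR (fun K => exists r, ~ J r /\ K = colon J r) (colon J 1).
  by exists 1.
(* If a r were outside J, maximality would give (J : a r) = (J : r), and a power of a lying in J
   would then force r into J. *)
have mr : m \sub colon J r.
  move=> a ma; apply: contrapT => nar.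
  have sub : colon J (a * r) \sub colon J r.
    apply: maxr; first by exists (a * r).
    by move=> x /= Jxr; rewrite mulrCA; apply: idealMl.
  have [n] := mI a ma => /IJ Jan.
  have : colon J r (a ^+ n) by rewrite mem_colon; apply: idealMr.
  elim: n {Jan} => [|n IHn]; first by rewrite mem_colon mul1r.
  by rewrite mem_colon exprSr -mulrA => /sub.
(* The module (r R + J)/J is a quotient of R/m. *)
have fin1 : finlen (pideal r * 1 + J) J.
  by apply: finlen_mull; apply: finlen_sub finlen1m => // x /mr.
apply: nfin; apply: finlenD fin1 => //; first exact: ideal_subDr.
apply: contrapT => nfin'; apply: nJr.
have sub : pideal r * 1 + J \sub J.
  apply: maxJ; last exact: ideal_subDr.
  by split=> // x /IJ; apply: ideal_subDr.
by apply/sub/ideal_subDl; rewrite mulr1; apply: pideal_id.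
Qed.

End Local.

(** * Regular sequences *)

Section RegularSequences.
Variable R : comNzRingType.
Implicit Types (I J K L M N Z : ideal R) (a b r x y z : R) (s t : seq R).

Definition nzdiv Z a : Prop := forall r, Z (r * a) -> Z r.

(** The base ideal Z is a parameter so that inductions can pass to the quotient by the first
    element. *)
Fixpoint regular Z s : Prop :=
  if s is a :: s' then nzdiv Z a /\ regular (Z + pideal a) s' else True.

Lemma regular_rcons Z s a :
  regular Z (rcons s a) <-> regular Z s /\ nzdiv (Z + span s) a.
Proof.
elim: s Z => [|b s IHs] Z /=; first by rewrite span_nil addr0; split=> -[].
rewrite span_cons addrA; split=> [[nzb /IHs[]] //|[[nzb rs] nza]].
by split=> //; apply/IHs.
Qed.

Lemma regular_nth Z s :
  (forall i, (i < size s)%N -> nzdiv (Z + span (take i s)) s`_i) -> regular Z s.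
Proof.
elim: s Z => [|a s IHs] Z nzs //=; split.
  by have := nzs 0%N isT; rewrite take0 span_nil addr0.
by apply: IHs => i ltis; have := nzs i.+1 ltis; rewrite /= span_cons addrA.
Qed.

Variable m : ideal R.
Hypothesis locR : local_ideal m.

Let noethR : noetherian R. Proof. by case: locR. Qed.

(** If k b lies in Z, then k = z + k' a with k' b again in Z, so [nakayama_mul] applies to (Z : b).
    The regularity of a modulo Z + (b) is then a direct computation. *)
Lemma nzdiv_swap Z a b : m a -> nzdiv Z a -> nzdiv (Z + pideal a) b ->
  nzdiv Z b /\ nzdiv (Z + pideal b) a.
Proof.
move=> ma nza nzb; split.
  apply: (nakayama_mul locR ma) => k Zkb.
  have [|z [_ [Zz [k' ->] kE]]] := nzb k; first exact: ideal_subDl.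
  exists k'; rewrite kE addrK; split=> //; apply: nza.
  rewrite mulrAC; have -> : k' * a * b = k * b - z * b by rewrite kE; ring.
  by apply: idealB => //; apply: idealMr.
move=> r [z [_ [Zz [c ->] raE]]].
have [|z' [_ [Zz' [c' ->] cE]]] := nzb c.
  exists (- z), (r * a); split; [exact: idealN|by exists r|by rewrite raE addKr].
exists (r - c' * b), (c' * b); split; rewrite ?subrK //; last by exists c'.
apply: nza; have -> : (r - c' * b) * a = z + z' * b by rewrite mulrBl raE cE; ring.
by apply: idealD => //; apply: idealMr.
Qed.

Lemma regular_rot1 Z s a : (forall x, x \in a :: s -> m x) ->
  regular Z (a :: s) -> regular Z (rcons s a).
Proof.
elim: s Z => [|b s IHs] Z //= ms [nza [nzb rs]].
have [|nzb' nza'] := nzdiv_swap _ nza nzb; first by apply/ms/mem_head.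
split=> //; apply: IHs => [x|/=]; last by rewrite addrAC.
by rewrite in_cons => xas; apply: ms; rewrite !in_cons orbCA xas orbT.
Qed.

Lemma regular_rotr1 Z s a : (forall x, x \in rcons s a -> m x) ->
  regular Z (rcons s a) -> regular Z (a :: s).
Proof.
elim: s Z => [|b s IHs] Z //= ms [nzb rs].
have /= [|nza rs'] := IHs (Z + pideal b) _ rs.
  by move=> x xs; apply: ms; rewrite in_cons xs orbT.
have [|nza' nzb'] := nzdiv_swap _ nzb nza; first by apply/ms/mem_head.
by rewrite addrAC.
Qed.

(* The annihilators A_i of (y + u_i t, s) modulo Z form a direct sum, because
   t is nilpotent on A_i :&: (sum of the A_j, j < i); hence some A_i vanishes. *)
Lemma prime_avoidance2 (u : nat -> R) Z y (t : R) s :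
  (forall i j, i != j -> ~ m (u i - u j)) ->
  (forall r, (forall x, x \in [:: y, t & s] -> Z (r * x)) -> Z r) ->
  exists i, forall r, (forall x, x \in y + u i * t :: s -> Z (r * x)) -> Z r.
Proof.
move=> uP annZ; apply: contrapT => nex.
have aex i : exists r, (forall x, x \in y + u i * t :: s -> Z (r * x)) /\ ~ Z r.
  apply: contrapT => na; apply: nex; exists i => r rZ; apply: contrapT => nZr.
  by apply: na; exists r.
have {aex} [a aP] := choice aex.
have [n an] := noetherian_seq noethR Z a.
(* Each a i with i < n is killed modulo Z by its own factor y + u i t, so their combination a n is
   killed by the whole product. *)
have {an} Zprod : Z (a n * \prod_(i < n) (y + u i * t)).
  suff sub : Z + span (mkseq a n) \sub colon Z (\prod_(i < n) (y + u i * t)) by apply: sub.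
  apply: ideal_subD; first by move=> x Zx; apply: idealMr.
  apply: span_sub => x /mapP[i]; rewrite mem_iota add0n => /andP[_ lin] ->.
  rewrite mem_colon (bigD1 (Ordinal lin)) //= mulrA; apply: idealMr.
  by apply: (aP i).1; apply: mem_head.
have [annan nZan] := aP n.
have Zant : Z (a n * t ^+ n).
  (* On a n, y acts as - u n t modulo Z, so the factor y + u k t acts as (u k - u n) t, a unit times
     t; the factors are traded for t one by one. *)
  have H k : (k <= n)%N -> Z (a n * t ^+ k * \prod_(k <= i < n) (y + u i * t)).
    elim: k => [_|k IHk ltkn]; first by rewrite expr0 mulr1 big_mkord.
    have {IHk} := IHk (ltnW ltkn); rewrite big_ltn // => Zk.
    have [_ _ /(_ _ (uP k n _))[|v v1]] := locR; first by rewrite neq_ltn ltkn.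
    set p := \prod_(_ <= _ < _) _ in Zk *.
    have -> : a n * t ^+ k.+1 * p = v * (a n * t ^+ k * ((y + u k * t) * p)
        - t ^+ k * p * (a n * (y + u n * t))).
      rewrite -(mul1r (a n * _ * p)) -v1 exprS; ring.
    by apply/idealMl/idealB => //; apply/idealMl/annan/mem_head.
  by have := H n (leqnn n); rewrite big_geq // mulr1.
(* At the last power of t that does not kill a n, the element a n t^k is killed by t, hence by y,
   and by s as well. *)
have [k [Zk nZk]] : exists k, Z (a n * t ^+ k.+1) /\ ~ Z (a n * t ^+ k).
  move: Zant; move: {2}n => j; elim: j => [|j IHj]; first by rewrite mulr1.
  by have [/IHj//|nZj Zj] := pselect (Z (a n * t ^+ j)); exists j.
apply/nZk/annZ => x; rewrite !in_cons => /or3P[/eqP->|/eqP->|xs].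
- have -> : a n * t ^+ k * y = t ^+ k * (a n * (y + u n * t))
      - u n * (a n * t ^+ k.+1) by rewrite exprS; ring.
  by apply: idealB; apply: idealMl => //; apply/annan/mem_head.
- by rewrite -mulrA -exprSr.
- by rewrite mulrAC; apply: idealMr; apply: annan; rewrite in_cons xs orbT.
Qed.

(** The elements of s are absorbed into y one at a time by [prime_avoidance2], until a single
    element has trivial annihilator. *)
Lemma prime_avoidance (u : nat -> R) Z y s :
  (forall i j, i != j -> ~ m (u i - u j)) ->
  (forall r, (forall x, x \in y :: s -> Z (r * x)) -> Z r) ->
  exists c, span s c /\ nzdiv Z (y + c).
Proof.
move=> uP; elim: s y => [|t s IHs] y annZ.
  exists 0; rewrite addr0; split; first exact: ideal0.
  by move=> r Zry; apply: annZ => x; rewrite inE => /eqP->.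
have [i /IHs [c [sc nzc]]] := prime_avoidance2 uP annZ.
exists (u i * t + c); rewrite addrA; split=> //; rewrite span_cons.
by exists (u i * t), c; split=> //; exists (u i).
Qed.

(* If a_1, ..., a_k is regular and the a_i are nilpotent modulo Z + (y_1, ..., y_k),
   then some y_1 + c, c in (y_2, ..., y_k), can replace a_k; permuting it to the
   front reduces the claim to Z + (y_1 + c) and y_2, ..., y_k. *)
Lemma regular_exchange (u : nat -> R) Z t s :
  (forall i j, i != j -> ~ m (u i - u j)) -> size s = size t ->
  (forall x, x \in t -> m x) -> (forall x, x \in s -> m x) -> regular Z t ->
  (forall r, m r -> exists n, r ^+ n \mem Z + span s) -> regular Z s.
Proof.
move=> uP; elim: s t Z => [//|y s IHs] t Z.
case/lastP: t => [//|t a]; rewrite size_rcons => -[sizes] mt ms.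
move=> /[dup] rt /regular_rcons[_ nza] nil.
(* If r kills y and s modulo Z + (t), a power of a kills r there, and a is regular modulo that
   ideal. *)
have [r|c [sc nzc]] := @prime_avoidance u (Z + span t) y s uP.
  move=> rys; have [|n Zan] := nil a; first by apply: mt; rewrite mem_rcons mem_head.
  have : r * a ^+ n \mem Z + span t.
    suff sub : Z + span (y :: s) \sub colon (Z + span t) r by rewrite mulrC; apply: sub.
    apply: ideal_subD => [x Zx|]; first by apply/idealMr/ideal_subDl.
    by apply: span_sub => x xys; rewrite mem_colon mulrC; apply: rys.
  elim: n {Zan} => [|n IHn]; first by rewrite mulr1.
  by rewrite exprSr mulrA => /nza.
have my : m y by apply: ms; apply: mem_head.
have ms' x : x \in s -> m x by move=> xs; apply: ms; rewrite in_cons xs orbT.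
have myc : m (y + c) by apply: idealD => //; apply: span_sub sc.
have [nzyc rt'] : regular Z (y + c :: t).
  apply: regular_rotr1 => [x|]; last first.
    by apply/regular_rcons; split=> //; have /regular_rcons[] := rt.
  rewrite mem_rcons in_cons => /orP[/eqP->//|xt].
  by apply: mt; rewrite mem_rcons in_cons xt orbT.
have rs' : regular (Z + pideal (y + c)) s.
  apply: (IHs t) => // [x xt|r /nil[n Zrn]].
    by apply: mt; rewrite mem_rcons in_cons xt orbT.
  exists n; rewrite -addrA.
  suff sub : Z + span (y :: s) \sub Z + (pideal (y + c) + span s) by apply: sub.
  rewrite span_cons.
  apply: ideal_subDD => //; apply: ideal_subD; last exact: ideal_subDr.
  apply: pideal_sub; exists (y + c), (- c); rewrite addrK; split=> //.
    exact: pideal_id.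
  exact: idealN.
apply: regular_rotr1 => [x|]; first by rewrite mem_rcons; apply: ms.
have /regular_rcons[rs nzs] : regular Z (rcons s (y + c)).
  by apply: regular_rot1 => // x; rewrite in_cons => /orP[/eqP->|/ms'].
(* Modulo (s), y and y + c agree. *)
apply/regular_rcons; split=> // r Zry; apply: nzs; rewrite mulrDr.
by apply: idealD => //; apply/ideal_subDr/idealMl.
Qed.

End RegularSequences.

(** * Powers of an ideal generated by a regular sequence *)

Section Powers.
Variable R : comNzRingType.
Implicit Types (I J K L M N Z : ideal R) (a b r x y z t : R) (s : seq R).

(** Separates the products of n + 1 factors that involve I from those in J alone. *)
Lemma ideal_exprDS I J n : (I + J) ^+ n.+1 = I * (I + J) ^+ n + J ^+ n.+1.
Proof.
elim: n => [|n IHn]; first by rewrite !expr1 expr0 mulr1.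
rewrite [LHS]exprS mulrDl {2}IHn mulrDr -exprS addrA; congr (_ + _).
rewrite addrC; apply: idealDK; rewrite mulrCA; apply: idealM_subM => //.
by rewrite exprS; apply: idealM_subM => //; apply: ideal_subDr.
Qed.

(** With T = (t, s), K T^(n+1) is t K T^n + K (s)^(n+1). After removal of the multiple b t,
    regularity of t modulo Z + (s)^(n+1) puts r - b in that ideal, and (s)^(n+1) lies in K T^n
    because (s) lies in K. *)
Lemma colon_exp Z K t s n r : (forall k, nzdiv (Z + span s ^+ k) t) ->
  span s \sub K -> r * t \mem Z + K * span (t :: s) ^+ n.+1 ->
  r \mem Z + K * span (t :: s) ^+ n.
Proof.
rewrite span_cons => nzt sK.
rewrite ideal_exprDS mulrDr mulrCA => -[z [_ [Zz [_ [w [/pidealM[b Kb ->] Kw ->]] rtE]]]].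
have /nzt[z' [w' [Zz' Sw' rbE]]] : (r - b) * t \mem Z + span s ^+ n.+1.
  have -> : (r - b) * t = z + w by rewrite mulrBl rtE; ring.
  exists z, w; split=> //.
  exact: idealM_subr Kw.
rewrite -(subrK b r) rbE -addrA; exists z', (w' + b); split=> //.
apply: idealD => //; suff sub : span s ^+ n.+1 \sub K * (pideal t + span s) ^+ n by apply: sub.
by rewrite exprS; apply: idealM_subM => //; apply/idealX_sub/ideal_subDr.
Qed.

Variable m : ideal R.
Hypothesis locR : local_ideal m.

(** Induction on the sequence, then on n. If r a lies in Z + (t, s)^n, the shorter sequence modulo t
    gives r = z + p t + w with w in (s)^n; cancelling t puts p a in Z + (t, s)^(n-1), and the
    induction on n handles p. *)
Lemma nzdiv_exp Z s a n : (forall x, x \in s -> m x) -> regular Z s ->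
  nzdiv (Z + span s) a -> nzdiv (Z + span s ^+ n) a.
Proof.
elim: s Z a n => [|t s IHs] Z a [|n] ms rs nza; try by move=> r _; apply: ideal_subDr.
  by move: nza; rewrite span_nil exprS mul0r.
have ms' x : x \in s -> m x by move=> xs; apply: ms; rewrite in_cons xs orbT.
have /regular_rcons[rs' nzt] := regular_rot1 locR ms rs.
have {}nzt k : nzdiv (Z + span s ^+ k) t by apply: IHs.
have colonE k r : r * t \mem Z + span (t :: s) ^+ k.+1 -> r \mem Z + span (t :: s) ^+ k.
  by have := @colon_exp Z 1 t s k r nzt; rewrite !mul1r; apply.
elim: n => [|n IHn]; first exact: nza.
set S := span (t :: s) in nza colonE IHn * => r Zra.
have sub : Z + S ^+ n.+2 \sub Z + pideal t + span s ^+ n.+2.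
  rewrite /S span_cons ideal_exprDS -addrA; apply: ideal_subDD => //.
  by apply: ideal_subDD => //; apply: idealM_subl.
have [|_ [w [[z [_ [Zz [p ->] ->]]] Sw rE]]] :=
    IHs (Z + pideal t) a n.+2 ms' rs.2 _ r (sub _ Zra).
  by rewrite -addrA -span_cons.
have tE : pideal t * S ^+ n.+1 \sub S ^+ n.+2.
  by rewrite (exprS _ n.+1); apply: idealM_subM => //; rewrite /S span_cons; apply: ideal_subDl.
have sS : span s ^+ n.+2 \sub S ^+ n.+2.
  by apply: idealX_sub; rewrite /S span_cons; apply: ideal_subDr.
have Zp : p \mem Z + S ^+ n.+1.
  apply/IHn/colonE; have -> : p * a * t = r * a - (z * a + w * a) by rewrite rE; ring.
  apply: idealB => //; exists (z * a), (w * a).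
  by split=> //; apply: idealMr => //; apply: sS.
case: Zp => z' [v [Zz' Sv pE]]; exists (z + z' * t), (v * t + w); split.
- by apply: idealD => //; apply: idealMr.
- by apply: idealD; [apply: tE; apply/pidealM; exists v|apply: sS].
- by rewrite rE pE; ring.
Qed.

(* S^n/KS^n is a free R/K-module on the monomials of degree n. *)
Lemma len_exp Z K s n : (forall x, x \in s -> m x) -> regular Z s ->
  Z + span s \sub K -> finlen 1 K ->
  finlen (Z + span s ^+ n) (Z + K * span s ^+ n) /\
  len (Z + span s ^+ n) (Z + K * span s ^+ n) = ('C((n + size s).-1, n) * len 1 K)%N.
Proof.
elim: s Z n => [|t s IHs] Z n ms rs sK finK.
all: have ZK : Z + K = K by apply/idealDK/(ideal_sub_trans _ sK)/ideal_subDl.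
all: have Z1 : Z + 1 = 1 by apply: idealDK.
  case: n => [|n]; first by rewrite expr0 mulr1 Z1 ZK bin0 mul1n.
  rewrite span_nil exprS mul0r mulr0 addr0 len_id addn0 bin_small //; split=> //.
  by exists 0%N => -[|k] //= [L [ZL LZ /chain_sub]].
elim: n => [|n [finn IHn]]; first by rewrite expr0 mulr1 Z1 ZK bin0 mul1n.
have ms' x : x \in s -> m x by move=> xs; apply: ms; rewrite in_cons xs orbT.
have /regular_rcons[rs' nzt] := regular_rot1 locR ms rs.
have {}nzt k : nzdiv (Z + span s ^+ k) t by apply: nzdiv_exp.
move: sK finn IHn; set S := span (t :: s) => sK finn IHn.
have SE : S = pideal t + span s by rewrite /S span_cons.
have tS : pideal t \sub S by rewrite SE; apply: ideal_subDl.
have SK : S \sub K by apply: ideal_sub_trans sK; apply: ideal_subDr.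
have sK' : span s \sub K by apply: ideal_sub_trans SK; rewrite SE; apply: ideal_subDr.
set A := Z + S ^+ n.+1; set B := Z + K * S ^+ n.+1.
set An := Z + S ^+ n in finn IHn; set Bn := Z + K * S ^+ n in finn IHn.
(* C is the part of A divisible by t, modulo B. Multiplication by t identifies An/Bn with C/B, and
   A/C is the degree n + 1 piece for s modulo t; the two lengths add up by Pascal's rule. *)
pose C := pideal t * An + B.
have BA : B \sub A by apply: ideal_subDD => //; apply: idealM_subr.
have BC : B \sub C by apply: ideal_subDr.
have tAn : pideal t * An \sub A.
  rewrite mulrDr; apply: ideal_subDD; first exact: idealM_subr.
  by rewrite exprS; apply: idealM_subM.
have CA : C \sub A by apply: ideal_subD.
have colonB : ideal_cap An (colon B t) = Bn.
  apply: ideal_ext => x; first by case=> _; apply: colon_exp.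
  move=> Bnx; split; first by move: Bnx; apply: ideal_subDD => //; apply: idealM_subr.
  move: Bnx => [z [w [Zz Kw ->]]]; rewrite mem_colon mulrDl.
  exists (z * t), (w * t); split=> //; first exact: idealMr.
  rewrite exprSr mulrA; apply: idealM_mem => //; exact/tS/pideal_id.
have capA : ideal_cap A (B + pideal t) = C.
  apply: ideal_ext => x; last first.
    move=> Cx; split; first exact: CA.
    by move: Cx; rewrite /C addrC; apply: ideal_subDD => //; apply: idealM_subl.
  move=> [Ax [b [_ [Bb [p ->] xE]]]]; exists (p * t), b; split=> //; last by rewrite xE addrC.
  apply/pidealM; exists p => //.
  have := @colon_exp Z 1 t s n p nzt; rewrite !mul1r; apply=> //.
  have -> : p * t = x - b by rewrite xE addrAC subrr add0r.
  by apply: idealB => //; apply: BA.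
(* This absorption reduces the next two equalities of ideals to semiring identities. *)
have tM I : pideal t + pideal t * I = pideal t.
  by rewrite addrC; apply/idealDK/idealM_subl.
have BtE : B + pideal t = Z + pideal t + K * span s ^+ n.+1.
  rewrite /B SE ideal_exprDS mulrDr mulrCA.
  by move: (_ ^+ n) => X; rewrite -[in RHS](tM (K * X)); ring.
have AtE : A + (B + pideal t) = Z + pideal t + span s ^+ n.+1.
  rewrite addrA (addrC A) (idealDK BA) /A SE ideal_exprDS.
  by move: (_ ^+ n) => X; rewrite -[in RHS](tM X); ring.
have [|fin' len'] := IHs (Z + pideal t) n.+1 ms' rs.2 _ finK.
  by rewrite -addrA -SE.
rewrite -AtE -BtE in fin' len'.
have finCB : finlen C B by apply: finlen_mull; rewrite colonB.
have finAC : finlen A C.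
  rewrite -capA; case: fin' => b hb; exists b => k chk; apply: hb.
  have := @chain_mull _ 1 A (B + pideal t) k; rewrite pideal1 mul1r => -[+ _]; apply.
  by apply: chain_subl chk => x [Ax /=]; rewrite mulr1.
have finAB : finlen A B by apply: finlenD finAC finCB.
split=> //; rewrite (lenD BC CA finAB) len_mull colonB IHn -capA -lenDr len'.
by rewrite -mulnDl /= !addnS /= binS.
Qed.

End Powers.

(** * Parameter ideals *)

Section ParameterIdeals.
Variables (R : comNzRingType) (m : ideal R) (d : nat).
Hypothesis locR : local_ideal m.
Implicit Types (I J K L M N Z : ideal R) (a b r x y z t : R) (s : seq R).

(** The unit ideal is included, so that I^0 is covered. *)
Definition primary_at I : Prop := forall r, m r -> exists n, r ^+ n \mem I.

Definition parameters s : Prop :=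
  [/\ size s = d, forall x, x \in s -> m x & primary_at (span s)].

(** The form in which the Cohen-Macaulay property enters here; [cm_regular_parameters] establishes
    it. *)
Hypothesis regular_parameters : forall s, parameters s -> regular 0 s.

Lemma finlen_primary_at I : primary_at I -> finlen 1 I.
Proof. exact: finlen_primary. Qed.

Lemma primary_at_sub I J : I \sub J -> primary_at I -> primary_at J.
Proof. by move=> IJ mI r /mI[n /IJ]; exists n. Qed.

Lemma primary_atM I J : primary_at I -> primary_at J -> primary_at (I * J).
Proof.
move=> mI mJ r mr; have [[i Ii] [j Jj]] := (mI r mr, mJ r mr).
by exists (i + j)%N; rewrite exprD; apply: idealM_mem.
Qed.

Lemma primary_atX I n : primary_at I -> primary_at (I ^+ n).
Proof.
move=> mI; elim: n => [|n IHn]; first by move=> r _; exists 0%N.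
by rewrite exprS; apply: primary_atM.
Qed.

(** Adds the lengths of S^n/S^(n+1), given by [len_exp] with K = S = (s). At n = 0 the binomial
    vanishes because d is positive. *)
Lemma len_param_exp s n : (0 < d)%N -> parameters s ->
  len 1 (span s ^+ n) = ('C((n + d).-1, d) * len 1 (span s))%N.
Proof.
move=> d_gt0 ps; have [sized ms mS] := ps; have rs := regular_parameters ps.
elim: n => [|n IHn]; first by rewrite expr0 len_id add0n bin_small // ltn_predL.
have finS k : finlen 1 (span s ^+ k) by apply/finlen_primary_at/primary_atX.
have SS : span s ^+ n.+1 \sub span s ^+ n by rewrite exprS; apply: idealM_subr.
rewrite (lenD SS) // IHn; have [|_] := len_exp locR n ms rs _ (finS 1%N).
  by rewrite add0r.
rewrite !add0r expr1 -exprS sized => ->; rewrite -mulnDl addSn.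
case: d d_gt0 => // d' _; rewrite !addnS /= binS; congr ((_ + _) * _)%N.
by rewrite -bin_sub ?leq_addr // addKn.
Qed.

Lemma len_param_mul s K n : parameters s -> span s \sub K ->
  len 1 (K * span s ^+ n) =
    (len 1 (span s ^+ n) + 'C((n + d).-1, n) * len 1 K)%N.
Proof.
move=> ps SK; have [sized ms mS] := ps; have rs := regular_parameters ps.
have mK : primary_at K by apply: primary_at_sub mS.
have [|_] := len_exp locR n ms rs _ (finlen_primary_at mK); first by rewrite add0r.
rewrite !add0r sized => <-; apply: lenD => //; first exact: idealM_subr.
by apply/finlen_primary_at/primary_atM => //; apply: primary_atX.
Qed.

(* Trade the generators for elements of I one at a time: t^2 in IJ gives
   (t - b) t in S with b in I and S spanned by the other generators, and t is
   regular modulo S, so t lies in I + S. *)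
Lemma param_sub_of_sqr I J s1 s2 : J * J \sub I * J ->
  parameters (s1 ++ s2) -> span (s1 ++ s2) = J -> (forall x, x \in s1 -> I x) ->
  J \sub I.
Proof.
move=> JI; elim: s2 s1 => [|t s2 IHs] s1 ps sJ s1I.
  by rewrite -sJ cats0; apply: span_sub.
have [sized ms mJ] := ps.
set S := span s1 + span s2.
have JE : pideal t + S = J.
  by rewrite -sJ span_cat span_cons addrCA.
have /regular_parameters : parameters (rcons (s1 ++ s2) t).
  split; first by rewrite -sized size_rcons !size_cat addnS.
    move=> x; rewrite mem_rcons in_cons mem_cat => xs; apply: ms.
    by rewrite mem_cat in_cons orbCA.
  by rewrite span_rcons span_cat addrC JE -sJ.
move=> /regular_rcons[_]; rewrite add0r span_cat -/S => nzt.
have Jt : J t by rewrite -JE; apply/ideal_subDl/pideal_id.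
have : t * t \mem I * (pideal t + S) by rewrite JE; apply: JI; apply: idealM_mem.
rewrite mulrDr mulrC => -[_ [w [/pidealM[b Ib ->] Iw ttE]]].
have [|v1 [v2 [S1 S2 tbE]]] := nzt (t - b).
  have -> : (t - b) * t = w by rewrite mulrBl ttE; ring.
  exact: idealM_subr Iw.
have tE : t = b + v1 + v2 by rewrite -addrA -tbE; ring.
have Iv1 : I v1 by apply: span_sub S1.
(* The element b + v1 lies in I and differs from t by v2 in (s2), so it can replace t as a
   generator. *)
have span' : span (b + v1 :: s1 ++ s2) = J.
  rewrite span_cons span_cat -/S -JE; apply: ideal_ext; apply: ideal_subD;
    try exact: ideal_subDr; apply: pideal_sub.
    rewrite -(addrK v2 (b + v1)) -tE; exists t, (- v2); split=> //.
      exact: pideal_id.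
    by apply: idealN; apply: ideal_subDr.
  exists (b + v1), v2; split=> //; first exact: pideal_id.
  exact: ideal_subDr.
apply: (IHs (b + v1 :: s1)) => //; last first.
  by move=> x; rewrite in_cons => /orP[/eqP->|/s1I//]; apply: idealD.
split=> /=; first by rewrite -sized !size_cat addnS.
  move=> x; rewrite in_cons => /orP[/eqP->|].
    have -> : b + v1 = t - v2 by rewrite tE addrK.
    apply: idealB; first by apply: ms; rewrite mem_cat mem_head orbT.
    apply: span_sub S2 => y ys; apply: ms.
    by rewrite mem_cat in_cons ys !orbT.
  rewrite mem_cat => xs; apply: ms; rewrite mem_cat in_cons.
  by case/orP: xs => ->; rewrite ?orbT.
by rewrite span' -sJ.
Qed.

(* With K = I1 + I2 one has X K <= I1 I2 = I1 J <= K J, where X K and K J have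
   the same colength because X and J are contained in K. *)
Lemma param_sub_of_min_mult I1 I2 sx sy :
  parameters sx -> parameters sy -> len 1 (span sx) = len 1 (span sy) ->
  span sx \sub I1 -> span sx \sub I2 -> span sy \sub I2 ->
  I1 * I2 = I1 * span sy -> span sy \sub I1.
Proof.
move=> px py lenxy; set X := span sx; set J := span sy => XI1 XI2 JI2 minmult.
pose K := I1 + I2.
have JK : J \sub K by apply: ideal_sub_trans JI2 _; apply: ideal_subDr.
have XK : X \sub K by apply: ideal_sub_trans XI1 _; apply: ideal_subDl.
have sub1 : K * X \sub I1 * J.
  rewrite -minmult mulrDl; apply: ideal_subD; first exact: idealM_subM.
  by rewrite mulrC; apply: idealM_subM.
have sub2 : I1 * J \sub K * J by apply: idealM_subM => //; apply: ideal_subDl.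
have fin : finlen 1 (K * X).
  have [_ _ mX] := px; apply/finlen_primary_at/primary_atM => //.
  exact: primary_at_sub mX.
have fin' : finlen 1 (I1 * J) by apply: finlen_sub fin.
have lenE : len 1 (K * X) = len 1 (K * J).
  have := len_param_mul 1 px XK; rewrite expr1 => ->.
  by have := len_param_mul 1 py JK; rewrite expr1 => ->; rewrite lenxy.
have KJ1 : K * J \sub 1 by [].
have I1J1 : I1 * J \sub 1 by [].
have E : K * J = I1 * J.
  apply: len_eq0 => //; first exact: finlen_sub fin'.
  move: lenE; rewrite (lenD sub1 I1J1 fin) (lenD sub2 KJ1 fin'); lia.
(* The exchange starts with no generator traded; its hypothesis holds because J J <= K J = I1 J. *)
apply: (@param_sub_of_sqr _ _ [::] sy) => //.
by rewrite -E; apply: idealM_subM.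
Qed.

End ParameterIdeals.

(** * Hilbert polynomials *)

Definition hpoly (k : nat) (c : nat -> int) (n : nat) : int :=
  \sum_(i < k.+1) (-1) ^+ i * c i * ('C(n + k - i, k - i))%:Z.

Lemma hpoly0 c n : hpoly 0 c n = c 0%N.
Proof. by rewrite /hpoly big_ord1 expr0 mul1r bin0 mulr1. Qed.

(** Pascal's rule: the first difference keeps the coefficients and lowers the degree, which drives
    the inductions on k below. *)
Lemma hpolyS k c n : hpoly k.+1 c n.+1 = hpoly k.+1 c n + hpoly k c n.+1.
Proof.
rewrite /hpoly big_ord_recr [in RHS]big_ord_recr /= !subnn !bin0 [RHS]addrAC.
congr (_ + _); rewrite -big_split; apply: eq_bigr => i _ /=.
have leik : (i <= k)%N by rewrite -ltnS.
rewrite -mulrDr -PoszD; congr (_ * Posz _).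
by rewrite !addnS addSn !subSn 1?binS //; lia.
Qed.

(** By induction on k the increments of the gap D are eventually positive integers, so D grows
    without bound; the shift r does not affect leading coefficients. *)
Lemma hpoly_lt_lead k c c' r : c' 0%N < c 0%N ->
  exists N : nat, forall n, (N <= n)%N -> hpoly k c' (n + r) < hpoly k c n.
Proof.
move=> ltc; elim: k => [|k [N ltN]]; first by exists 0%N => n _; rewrite !hpoly0.
pose D n := hpoly k.+1 c n - hpoly k.+1 c' (n + r).
have DS n : D n.+1 = D n + (hpoly k c n.+1 - hpoly k c' (n.+1 + r)).
  by rewrite /D addSn !hpolyS; ring.
have DN j : D N + j%:Z <= D (N + j)%N.
  elim: j => [|j IHj]; first by rewrite addr0 addn0.
  rewrite addnS DS; have := ltN (N + j).+1 (leq_trans (leq_addr j N) (leqnSn _)).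
  by move: IHj; lia.
(* D gains at least 1 per step from N on, so it becomes positive after at most |D N| + 1 steps. *)
exists (N + `|D N| + 1)%N => n leNn; rewrite -subr_gt0 -/(D n).
have := DN (n - N)%N; rewrite subnKC; last by lia.
by lia.
Qed.

Lemma hpoly_le_lead k c c' r :
  (exists N : nat, forall n, (N <= n)%N -> hpoly k c n <= hpoly k c' (n + r)) ->
  c 0%N <= c' 0%N.
Proof.
move=> [N leN]; rewrite leNgt; apply/negP => /(hpoly_lt_lead k r)[N' ltN'].
have := leN (maxn N N') (leq_maxl _ _).
by rewrite leNgt ltN' // leq_maxr.
Qed.

(** First differences determine all coefficients but the last, which one value then determines. *)
Lemma hpoly_inj k c c' :
  (exists N : nat, forall n, (N <= n)%N -> hpoly k c n = hpoly k c' n) ->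
  forall i, (i <= k)%N -> c i = c' i.
Proof.
elim: k => [|k IHk] [N eqN] i.
  by rewrite leqn0 => /eqP->; have := eqN N (leqnn N); rewrite !hpoly0.
have eqc j : (j <= k)%N -> c j = c' j.
  apply: IHk; exists N.+1 => -[//|n] leNn.
  have := eqN n.+1 (leqW leNn); rewrite !hpolyS eqN //; exact: addrI.
rewrite leq_eqVlt => /predU1P[->|]; last exact: eqc.
have := eqN N (leqnn N); rewrite /hpoly big_ord_recr [in RHS]big_ord_recr /=.
rewrite (eq_bigr (fun j : 'I_k.+1 => (-1) ^+ j * c' j * ('C(N + k.+1 - j, k.+1 - j))%:Z)).
  by move/addrI; rewrite subnn bin0 !mulr1; apply: mulfI; rewrite signr_eq0.
by move=> j _; rewrite eqc // -ltnS.
Qed.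

(** The index shift left by the cancelled leading terms flips every sign, hence the reversed
    difference of coefficients. *)
Lemma hpolyB k c c' n : c 0%N = c' 0%N ->
  hpoly k.+1 c n - hpoly k.+1 c' n = hpoly k (fun i => c' i.+1 - c i.+1) n.
Proof.
move=> c0; rewrite /hpoly !(big_ord_recl k.+1) /= c0 opprD addrACA subrr add0r -sumrB.
apply: eq_bigr => i _; rewrite /bump /= !add1n addnS !subSS exprS; ring.
Qed.

Lemma hpoly_linear k c n : (forall i, (2 <= i)%N -> c i = 0) ->
  hpoly k.+1 c n =
    c 0%N * ('C(n + k.+1, k.+1))%:Z - c 1%N * ('C(n + k, k))%:Z.
Proof.
move=> c0; rewrite /hpoly !big_ord_recl big1 => [|i _]; last first.
  by rewrite c0 ?mulr0 ?mul0r.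
by rewrite /= /bump /= !subn0 expr0 mul1r addr0 addnS !subn1 expr1 mulN1r mulNr.
Qed.

(** The coefficients of 1 / (1 - t)^(k+1) are C(n + k, k); the case distinction gives the shifted
    series the coefficient 0 at n = 0. *)
Lemma series_quot_linear (a b : int) k n :
  series_quot (a%:P - b%:P * 'X) k.+1 n =
    a * ('C(n + k, k))%:Z - b * (if n is n'.+1 then 'C(n' + k, k) else 0%N)%:Z.
Proof.
elim: k n => [|k IHk] n.
  rewrite /series_quot /= !addn0 !bin0 mulr1.
  elim: n => [|n IHn]; last rewrite big_ord_recr /= IHn.
    by rewrite big_ord1 coefB coefC coefMX /= mulr0.
  rewrite coefB coefC coefMX coefC /= sub0r.
  by case: n {IHn} => [|n] /=; rewrite ?addn0 ?bin0; ring.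
have -> : series_quot (a%:P - b%:P * 'X) k.+2 n =
  \sum_(i < n.+1) series_quot (a%:P - b%:P * 'X) k.+1 i by [].
elim: n => [|n IHn]; first by rewrite big_ord1 IHk !add0n !binn.
have binE q : 'C(q.+1 + k.+1, k.+1) = ('C(q + k.+1, k.+1) + 'C(q.+1 + k, k))%N.
  by rewrite addSn binS addSnnS.
rewrite big_ord_recr IHn IHk /= binE PoszD.
case: n {IHn} => [|n]; first by rewrite !add0n !binn; ring.
by rewrite [in 'C(n.+1 + k.+1, _)]binE PoszD; ring.
Qed.

(** * Cohen-Macaulay local rings *)

Section CohenMacaulay.
Variables (R : comNzRingType) (m : ideal R) (d : nat).
Implicit Types (I J K L M N Z : ideal R) (a b r x y z t : R) (s : seq R).

(** A non-unit lies in a maximal ideal, supplied by [noetherian_max], and the only one is m. *)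
Lemma noetherian_local_ideal : noetherian_local (ideal_mem m) -> local_ideal m.
Proof.
move=> [noethR [[_ m1] _] unim]; split=> // r nmr; apply: contrapT => nu.
have nr1 : ~ pideal r 1 by move=> [u u1]; apply: nu; exists u.
have [|M [[rM nM1] maxM]] :=
  @noetherian_max _ noethR (fun K => pideal r \sub K /\ ~ K 1) (pideal r); first by split.
apply: nmr; rewrite -(unim (ideal_mem M)); first exact/rM/pideal_id.
split; first by split=> //; apply: ideal_memP.
move=> J [hJ nJ1] MJ; apply/seteqP; split=> //.
apply: (maxM (Ideal hJ)) => //; split=> // x /rM; exact: MJ.
Qed.

Lemma infinite_residue_seq : infinite_residue_field (ideal_mem m) ->
  exists u : nat -> R, forall i j, i != j -> ~ m (u i - u j).
Proof.
move=> /infiniteP/pcard_leP/unsquash f.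
have uex i : exists r, [set x | m (x - r)] = f i.
  by have [r _ rE] : range (fun r => [set x | m (x - r)]) (f i); [exact: funS|exists r].
have [u uE] := choice uex; exists u => i j /eqP nij mij; apply: nij.
have finj : f i = f j -> i = j by move=> fij; apply: (inj (f := f)); rewrite ?inE.
apply: finj; rewrite -!uE; apply/seteqP; split=> x /= mx.
  by rewrite -(subrKA (u i)); apply: idealD.
by rewrite -(subrKA (u j)) -(opprB (u i)); apply: idealB.
Qed.

Hypothesis Rcm : cohen_macaulay_local (ideal_mem m) d.
Hypothesis Rinf : infinite_residue_field (ideal_mem m).

Lemma cm_local : local_ideal m.
Proof. by apply: noetherian_local_ideal; case: Rcm. Qed.

(** Depth d provides a regular sequence of length d in m, and [regular_exchange] transfers its
    regularity to s. *)
Lemma cm_regular_parameters s : parameters m d s -> regular 0 s.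
Proof.
move=> [sized ms mS]; have [_ _ [[t [[[_ rt] mt] sizet]] _]] := Rcm.
have [u uP] := infinite_residue_seq Rinf.
apply: (regular_exchange cm_local uP (t := t)) => //; first by rewrite sized.
- apply: regular_nth => i ltit r; rewrite add0r.
  have genE k : ideal_gen [set` take k t] = ideal_mem (span (take k t)).
    exact: ideal_gen_span.
  by have := rt i ltit r; rewrite genE mulrC.
- by move=> r /mS; rewrite add0r.
Qed.

Lemma ideal_mem_inj I J : ideal_mem I = ideal_mem J -> I = J.
Proof. by move=> IJ; apply: ideal_ext => x; rewrite IJ. Qed.

Lemma ideal_exp_mem I n : ideal_exp (ideal_mem I) n = ideal_mem (I ^+ n).
Proof.
elim: n => [|n IHn]; first by apply/seteqP.
by rewrite exprS /ideal_exp iterS -/(ideal_exp _ n) IHn.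
Qed.

Lemma radical_primary_at I : radical (ideal_mem I) = ideal_mem m ->
  primary_at m I /\ I \sub m.
Proof.
move=> radI; split=> [r|x Ix]; rewrite -?radI //.
by exists 1%N.
Qed.

(** The reduction equation places a power of I inside the ideal of the y i, so these d generators
    are parameters. *)
Lemma reduction_parameters I (y : 'I_d -> R) :
  radical (ideal_mem I) = ideal_mem m ->
  reduction (ideal_gen (range y)) (ideal_mem I) ->
  exists s, [/\ parameters m d s, ideal_gen (range y) = ideal_mem (span s),
    span s \sub I & exists r : nat, span s * I ^+ r = I ^+ r.+1].
Proof.
move=> /radical_primary_at[mI Im] red; exists (codom y).
have genE : ideal_gen (range y) = ideal_mem (span (codom y)).
  apply: ideal_gen_span => x; split=> [[i _ <-]|/codomP[i ->]]; last by exists i.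
  exact: codom_f.
move: red; rewrite genE => -[_ yI [r rE]].
have {}rE : span (codom y) * I ^+ r = I ^+ r.+1.
  by apply: ideal_mem_inj; rewrite -ideal_exp_mem -rE ideal_exp_mem.
split=> //; last by exists r.
split; first by rewrite size_codom card_ord.
  by move=> x /mem_span/yI/Im.
apply: (primary_at_sub (I := I ^+ r.+1)); last exact: primary_atX.
by rewrite -rE; apply: idealM_subl.
Qed.

(** With S = (s), I^(n+r) = S^n I^r lies in S^n, which lies in I^n. The two length functions thus
    bound each other up to the shift r, and their leading coefficients agree. *)
Lemma multiplicity_parameters I s (r : nat) e : (0 < d)%N -> parameters m d s ->
  span s \sub I -> span s * I ^+ r = I ^+ r.+1 ->
  hilbert_coefs d (fun n => len 1 (I ^+ n)) e -> e 0%N = (len 1 (span s))%:Z.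
Proof.
move=> d_gt0 ps SI redS [N eN].
have locR := cm_local; have rp := cm_regular_parameters.
have [_ _ mS] := ps; have mI := primary_at_sub SI mS.
have finI n : finlen 1 (I ^+ n) by apply: (finlen_primary_at locR); apply: primary_atX.
have finS n : finlen 1 (span s ^+ n) by apply: (finlen_primary_at locR); apply: primary_atX.
(* Since C(n+d-1, d) = C(n+d, d) - C(n+d-1, d-1), the first two coefficients both equal the colength
   of (s). *)
pose c i := if (i < 2)%N then (len 1 (span s))%:Z else 0 : int.
have cE n : hpoly d c n = (len 1 (span s ^+ n))%:Z.
  rewrite (len_param_exp locR rp n d_gt0 ps) -(prednK d_gt0).
  rewrite hpoly_linear => [|i i2]; last by rewrite /c ltnNge i2.
  by rewrite /c /= addnS binS /= !PoszM PoszD; ring.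
have len_anti J K : J \sub K -> finlen 1 J -> (len 1 K <= len 1 J)%N.
  by move=> JK finJ; rewrite (lenD JK) // leq_addr.
have redSn n : I ^+ (n + r) = span s ^+ n * I ^+ r.
  elim: n => [|n IHn]; first by rewrite expr0 mul1r.
  by rewrite addSn exprS IHn mulrCA -exprS -redS mulrA -exprSr.
apply/eqP; rewrite eq_le; apply/andP; split.
  rewrite -[leRHS]/(c 0%N); apply: (@hpoly_le_lead d _ _ 0); exists N => n leNn.
  rewrite addn0 cE; have := eN n leNn; rewrite -/(hpoly d e n) => <-.
  by rewrite lez_nat len_anti //; apply: idealX_sub.
rewrite -[leLHS]/(c 0%N); apply: (@hpoly_le_lead d _ _ r); exists N => n leNn.
rewrite cE; have := eN (n + r)%N (leq_trans leNn (leq_addr _ _)).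
rewrite -/(hpoly d e _) => <-.
by rewrite lez_nat len_anti // redSn; apply: idealM_subl.
Qed.

End CohenMacaulay.

(** The equality I1 I2 = I1 S iterates to I1 I2^n = I1 S^n, whose colength is given by
    [len_param_mul] because S lies in I1. *)
Lemma len_min_mult (R : comNzRingType) (m : ideal R) (d : nat) (I1 I2 : ideal R)
    (s : seq R) (n : nat) :
  local_ideal m -> (forall t, parameters m d t -> regular 0 t) ->
  (0 < d)%N -> parameters m d s -> span s \sub I1 ->
  I1 * I2 = I1 * span s ->
  len 1 (I1 * I2 ^+ n) =
    ('C((n + d).-1, d) * len 1 (span s) + 'C((n + d).-1, d.-1) * len 1 I1)%N.
Proof.
move=> locR rp d_gt0 ps sI1 minmult.
have -> : I1 * I2 ^+ n = I1 * span s ^+ n.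
  elim: n => // n IHn.
  by rewrite exprS mulrA minmult mulrAC IHn mulrAC -mulrA -exprS.
rewrite (len_param_mul locR rp) // (len_param_exp locR rp) //.
congr (_ + _ * _)%N; rewrite -[RHS]bin_sub; last by lia.
by congr 'C(_, _); lia.
Qed.

Theorem theorem7p2 (R : comNzRingType) (m : set R) (d : nat)
    (I1 I2 : set R) (x : 'I_d -> R) (g e f : nat -> int)
    (Rcm : cohen_macaulay_local m d) (d_ge1 : (1 <= d)%N)
    (Rinf : infinite_residue_field m)
    (I1prim : primary_to m I1) (I2prim : primary_to m I2)
    (I2min : minimal_multiplicity d I2 I1)
    (xred : minimal_reduction (ideal_gen (range x)) I2)
    (xI1 : ideal_gen (range x) `<=` I1)
    (gE : hilbert_coefs d
            (fun n => length setT (ideal_mul I1 (ideal_exp I2 n))) g)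
    (eE : hilbert_coefs d (fun n => length setT (ideal_exp I2 n)) e)
    (fE : hilbert_coefs d.-1
            (fun n => length (ideal_exp I2 n)
                             (ideal_mul I1 (ideal_exp I2 n))) f) :
  let l1 : int := (length setT I1)%:Z in
  let h : {poly int} := l1%:P - (l1 - e 0%N)%:P * 'X in
  [/\ (forall n : nat,
         (length setT (ideal_mul I1 (ideal_exp I2 n)))%:Z
         = series_quot h d.+1 n),
      g 1%N = e 0%N - l1 /\
        (forall i : nat, (2 <= i <= d)%N -> g i = 0),
      (forall n : nat,
         (length (ideal_exp I2 n) (ideal_mul I1 (ideal_exp I2 n)))%:Z
         = series_quot h d.+1 n - (length setT (ideal_exp I2 n))%:Z)
    & f 0%N = e 1%N - e 0%N + l1 /\
        (forall i : nat, (1 <= i <= d.-1)%N -> f i = e i.+1)].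
Proof.
move=> l1 h.
have [[_ [[hm _] _] _] _ _] := Rcm.
have [[[h1 _] _] rad1] := I1prim; have [[[h2 _] _] rad2] := I2prim.
have {hm} [m' mE] : exists m', m = ideal_mem m' by exists (Ideal hm).
have {h1} [K1 I1E] : exists K1, I1 = ideal_mem K1 by exists (Ideal h1).
have {h2} [K2 I2E] : exists K2, I2 = ideal_mem K2 by exists (Ideal h2).
subst I1 I2; rewrite mE in Rcm Rinf rad1 rad2.
have locR := cm_local Rcm; have rp := cm_regular_parameters Rcm Rinf.
have [mK1 _] := radical_primary_at rad1; have [mK2 _] := radical_primary_at rad2.
have [J [[Jred _] [y JE] minmult]] := I2min; subst J.
have [sy [py yE yK2 [ry redy]]] := reduction_parameters rad2 Jred.
have [sx [px xE xK2 [rx redx]]] := reduction_parameters rad2 xred.1.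
rewrite xE in xI1; rewrite yE in minmult.
have {}minmult : K1 * K2 = K1 * span sy.
  by apply: (@has_length_eq0 _ (K1 * K2) (K1 * span sy)) minmult; apply: idealM_subM.
have len2E n : length setT (ideal_exp (ideal_mem K2) n) = len 1 (K2 ^+ n).
  by rewrite ideal_exp_mem.
have len12E n : length setT (ideal_mul (ideal_mem K1) (ideal_exp (ideal_mem K2) n)) =
    len 1 (K1 * K2 ^+ n) by rewrite ideal_exp_mem.
have lenFE n : length (ideal_exp (ideal_mem K2) n)
    (ideal_mul (ideal_mem K1) (ideal_exp (ideal_mem K2) n)) =
    len (K2 ^+ n) (K1 * K2 ^+ n) by rewrite ideal_exp_mem.
rewrite (funext len12E) in gE; rewrite (funext len2E) in eE; rewrite (funext lenFE) in fE.
(* Both parameter ideals have colength e 0, the equality that [param_sub_of_min_mult] asks for. *)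
have e0x := multiplicity_parameters Rcm Rinf d_ge1 px xK2 redx eE.
have e0y := multiplicity_parameters Rcm Rinf d_ge1 py yK2 redy eE.
have yK1 : span sy \sub K1.
  apply: (param_sub_of_min_mult locR rp px py) minmult => //.
  by apply/eqP; rewrite -eqz_nat -e0x -e0y.
have len1E n : (len 1 (K1 * K2 ^+ n))%:Z =
    e 0%N * ('C((n + d).-1, d))%:Z + l1 * ('C((n + d).-1, d.-1))%:Z.
  by rewrite (len_min_mult n locR rp d_ge1 py yK1 minmult) PoszD !PoszM -e0y; ring.
have lenD12 n : (len (K2 ^+ n) (K1 * K2 ^+ n))%:Z =
    (len 1 (K1 * K2 ^+ n))%:Z - (len 1 (K2 ^+ n))%:Z.
  rewrite (@lenD _ 1 (K2 ^+ n)) //; first by rewrite PoszD; ring.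
    exact: idealM_subr.
  by apply: (finlen_primary_at locR); apply/primary_atM => //; apply: primary_atX.
clear len2E len12E lenFE.
have [d' dE] : exists d', d = d'.+1 by exists d.-1; rewrite prednK.
(* Pascal's rule turns e 0 C(n+d-1, d) + l1 C(n+d-1, d-1) into e 0 C(n+d, d) - (e 0 - l1) C(n+d-1,
   d-1). *)
pose c (i : nat) : int := if i is i'.+1 then if i' is 0 then e 0%N - l1 else 0 else e 0%N.
have cE n : (len 1 (K1 * K2 ^+ n))%:Z = hpoly d c n.
  rewrite len1E dE hpoly_linear; last by case=> [|[]].
  by rewrite /c addnS binS /= PoszD; ring.
have seriesE n : (len 1 (K1 * K2 ^+ n))%:Z = series_quot h d.+1 n.
  rewrite /h series_quot_linear len1E dE; case: n => [|n].
    by rewrite !add0n !binn bin_small //; ring.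
  by rewrite addSn binS /= PoszD; ring.
have gcE : forall i, (i <= d)%N -> g i = c i.
  apply: (@hpoly_inj d); have [N gN] := gE; exists N => n leNn.
  by rewrite -cE gN.
(* The length of I2^n/(I1 I2^n) is a difference of two colengths with the same leading coefficient e
   0, so the degree drops and the indices shift by one. *)
have feE : forall i, (i <= d')%N -> f i = e i.+1 - c i.+1.
  have [[N1 fN] [N2 eN]] := (fE, eE); rewrite dE /= in fN eN.
  apply: (@hpoly_inj d'); exists (maxn N1 N2) => n.
  rewrite geq_max => /andP[/fN fn /eN en].
  rewrite -(hpolyB d' (c := c)) // -[in RHS]dE -cE dE.
  by rewrite -[hpoly d' f n]fn lenD12 en.
split.
- by move=> n; rewrite -seriesE ideal_exp_mem.
- split=> [|i /andP[i2 id]]; first exact: gcE.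
  by rewrite gcE //; case: i i2 {id} => [|[]].
- by move=> n; rewrite -seriesE !ideal_exp_mem -lenD12.
- split=> [|i /andP[i1 id]]; first by rewrite feE //= opprB addrA addrAC.
  rewrite feE; last by move: id; rewrite dE.
  by case: i i1 {id} => [|i] //= _; rewrite subr0.
Qed.
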